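(* Let $c_1, c_2>0$ and define $$F_3(x,y) = \big(\min\{-x,y\},\ y + x - \min\{-x,y\}\big).$$ Then $F_3: \mathbb{R}^2 \rightarrow \mathbb{R}^2$ is an involution, while $F_3: [-c_1, c_2] \times [-c_2, \infty) \rightarrow [-c_2, c_1] \times [-c_1, \infty)$ is a bijection. Let $X$ and $Y$ be $\mathbb{R}$-valued independent random variables with densities $f_X$ and $f_Y$ satisfying $f_X(x) > 0$ when $x \in [-c_1, c_2]$ and $f_X(x) = 0$ otherwise, and $f_Y(y) > 0$ when $y \in [-c_2, \infty)$ and $f_Y(y) = 0$ otherwise. Moreover, assume that the densities are twice-differentiable inside their respective supports. Let $(U,V) := F_3(X,Y)$. Then $U$ and $V$ are independent if and only if there exists $\lambda > 0$ such that $$X \sim \mathrm{stExp}(\lambda, -c_1, c_2) \quad\text{and}\quad Y \sim \mathrm{sExp}(\lambda, -c_2),$$ in which case $U \sim \mathrm{stExp}(\lambda, -c_2, c_1)$ and $V \sim \mathrm{sExp}(\lambda, -c_1)$. Hence, if moreover $(U,V)$ has the same distribution as $(X,Y)$, then $X \sim \mathrm{stExp}(\lambda,-c,c)$ and $Y \sim \mathrm{sExp}(\lambda,-c)$ for some $c > 0$. Furthermore, for $c>0$, $F_3: [-c, c] \times [-c,\infty) \rightarrow [-c, c] \times [-c,\infty)$ is an involution.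
   Context: Shifted exponential distribution: for $\lambda > 0$ and $c \in \mathbb{R}$, $\mathrm{sExp}(\lambda,c)$ is the probability distribution on $\mathbb{R}$ with density $$\frac{1}{Z} e^{-\lambda x}\, \mathbf{1}_{[c,\infty)}(x), \qquad x \in \mathbb{R},\qquad Z = \frac{1}{\lambda} e^{-\lambda c}.$$ Shifted truncated exponential distribution: for $\lambda > 0$ and $d_1,d_2 \in \mathbb{R}$ with $d_1 < d_2$, $\mathrm{stExp}(\lambda,d_1,d_2)$ is the probability distribution on $\mathbb{R}$ with density $$\frac{1}{Z} e^{-\lambda x}\, \mathbf{1}_{[d_1,d_2]}(x), \qquad x \in \mathbb{R},\qquad Z = \frac{1}{\lambda} \left(e^{-\lambda d_1} - e^{-\lambda d_2}\right).$$ Densities are with respect to Lebesgue measure. *)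

(* Defs.v *)
From HB Require Import structures.
From mathcomp Require Import all_boot all_order all_algebra.
From mathcomp Require Import all_classical all_reals all_analysis.

Set Implicit Arguments.
Unset Strict Implicit.
Unset Printing Implicit Defensive.

Import Order.TTheory GRing.Theory Num.Theory.
Import numFieldNormedType.Exports.

Local Open Scope classical_set_scope.
Local Open Scope ring_scope.

Definition F3 {R : realType} (p : R * R) : R * R :=
  (Num.min (- p.1) p.2, p.2 + p.1 - Num.min (- p.1) p.2).

Definition sExp_pdf {R : realType} (lambda c : R) (x : R) : R :=
  let Z := lambda^-1 * expR (- lambda * c) in
  Z^-1 * expR (- lambda * x) * \1_(`[c, +oo[ : set R) x.

Definition stExp_pdf {R : realType} (lambda d1 d2 : R) (x : R) : R :=
  let Z := lambda^-1 * (expR (- lambda * d1) - expR (- lambda * d2)) in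
  Z^-1 * expR (- lambda * x) * \1_(`[d1, d2] : set R) x.

Definition sExp {R : realType} (lambda c : R) (A : set R) : \bar R :=
  (\int[lebesgue_measure]_(x in A) (sExp_pdf lambda c x)%:E)%E.

Definition stExp {R : realType} (lambda d1 d2 : R) (A : set R) : \bar R :=
  (\int[lebesgue_measure]_(x in A) (stExp_pdf lambda d1 d2 x)%:E)%E.

(* Laws are set functions on all subsets, so they are only compared on
   measurable sets; Leibniz equality would constrain their arbitrary values
   on non-measurable ones. *)
Definition same_law {d : measure_display} {T : measurableType d} {R : realType}
    (mu nu : set T -> \bar R) : Prop :=
  forall A : set T, measurable A -> mu A = nu A.

Definition has_density {R : realType} (mu : set R -> \bar R) (f : R -> R)
    : Prop :=
  [/\ measurable_fun setT f,
      forall x, 0 <= f x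
    & same_law mu (fun A => \int[lebesgue_measure]_(x in A) (f x)%:E)%E].

Definition independent_rv {d d1 d2 : measure_display} {T : measurableType d}
    {T1 : measurableType d1} {T2 : measurableType d2} {R : realType}
    (P : probability T R) (X : T -> T1) (Y : T -> T2) : Prop :=
  forall (A : set T1) (B : set T2), measurable A -> measurable B ->
    P (X @^-1` A `&` Y @^-1` B) = (P (X @^-1` A) * P (Y @^-1` B))%E.

(* Meant for an open D, where f^`() is the derivative of f near each point. *)
Definition twice_differentiable_on {R : realType} (D : set R) (f : R -> R)
    : Prop :=
  forall x, D x -> derivable f x 1 /\ derivable (f^`())%classic x 1.

(* Main.v *)
Require Import Defs.
From HB Require Import structures.
From mathcomp Require Import all_boot all_order all_algebra.
From mathcomp Require Import all_classical all_reals all_analysis.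
From mathcomp Require Import measurable_realfun ring lra.

(** Write s = x + y. Since min (-x) y = min 0 s - x, the map F3 keeps s fixed
and reflects x into min 0 s - x. This explains that F3 is an involution
[F3_involutive], and that it preserves the planar Lebesgue measure: it is a
shear, followed on each line of constant s by a reflection, followed by the
inverse shear [ge0_integral_F3]. Hence if X and Y are independent with
densities f and h, then (U, V) = F3 (X, Y) has the density
g p = f (F3 p).1 * h (F3 p).2 [joint_density_F3].

Exponential laws give independence. As u + v = x + y, the product of
exp (- la x) and exp (- la y) is that of exp (- la u) and exp (- la v); as F3
exchanges the two strips, g is again a product of a truncated exponential and
an exponential density, with c1 and c2 exchanged [exp_tensor_F3].

Independence gives exponential laws. The law of (U, V) on the product of two
short intervals is the product of its marginals; dividing by the area and
letting the intervals shrink, the continuity of g yields the pointwise identity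
g (u, v) g (u', v') = g (u, v') g (u', v) inside the support
[independent_density_rank1]. On the half-plane u + v <= 0 the map F3 is the swap
(v, u), and on u + v >= 0 it is (- u, v + 2 u), so suitable choices of the four
points give
  h (- x) f v = f x h (v - 2 x)           for - c1 < x <= v < c2,
  h (c2 + t) h y = h (y + t) h c2         for y >= c2 and t near 0.
The first one says that the logarithmic derivative of f at v equals that of h
at every point of ]- v, v + 2 c1[; all these intervals contain c1, so both
logarithmic derivatives are one and the same constant - la, for h as far as
c2 + 2 c1. The second one carries this to the whole half-line
[rank1_exponential]. Integrability of h forces la > 0, and the normalizing
constants follow from the total mass 1.

If moreover (U, V) and (X, Y) have the same law, then U and V inherit the
independence of X and Y, so the laws are exponential, and X and U have the same
law; truncated exponential laws of rate la on [- c1, c2] and on [- c2, c1] agree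
only if c1 = c2 [stExp_swap_inj]. *)

Set Implicit Arguments.
Unset Strict Implicit.
Unset Printing Implicit Defensive.

Import Order.TTheory GRing.Theory Num.Theory.
Import numFieldNormedType.Exports.

Local Open Scope classical_set_scope.
Local Open Scope ring_scope.

Local Notation leb := lebesgue_measure.

(** * The piecewise linear involution *)

(** The form of F3 in the coordinates (x, s) with s = x + y: s is kept and x is
reflected. Everything measure-theoretic about F3 is read off from it. *)
Lemma F3_shear {R : realType} (x y : R) :
  F3 (x, y) = (Num.min 0 (y + x) - x, y + x - (Num.min 0 (y + x) - x)).
Proof.
rewrite /F3/=; have -> // : Num.min (- x) y = Num.min 0 (y + x) - x.
by rewrite addr_minl add0r addrK.
Qed.

Lemma F3_involutive {R : realType} : involutive (@F3 R).
Proof.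
move=> [x y]; rewrite !F3_shear subrK.
by congr (_, _); ring.
Qed.

Lemma F3_below {R : realType} (u v : R) : u + v <= 0 -> F3 (u, v) = (v, u).
Proof.
move=> uv; rewrite /F3/=.
have -> : Num.min (- u) v = v by apply/min_idPr; rewrite -subr_le0 opprK addrC.
by congr (_, _); ring.
Qed.

Lemma F3_above {R : realType} (u v : R) :
  0 <= u + v -> F3 (u, v) = (- u, v + 2 * u).
Proof.
move=> uv; rewrite /F3/=.
have -> : Num.min (- u) v = - u.
  by apply/min_idPl; rewrite -subr_ge0 opprK addrC.
by congr (_, _); ring.
Qed.

(** Both sides are systems of linear inequalities on each of the two half-planes
where F3 is linear. *)
Lemma F3_strip {R : realType} (c1 c2 : R) (p : R * R) :
  ((F3 p).1 \in `[- c1, c2]) && ((F3 p).2 \in `[- c2, +oo[) =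
  (p.1 \in `[- c2, c1]) && (p.2 \in `[- c1, +oo[).
Proof.
case: p => u v; have [uv|/ltW uv] := leP (u + v) 0.
  rewrite F3_below// !in_itv/= !andbT.
  by apply/idP/idP => ?; lra.
rewrite F3_above// !in_itv/= !andbT.
by apply/idP/idP => ?; lra.
Qed.

Lemma F3_strip_bij {R : realType} (c1 c2 : R) :
  set_bij (`[- c1, c2] `*` `[- c2, +oo[) (`[- c2, c1] `*` `[- c1, +oo[)
    (@F3 R).
Proof.
have toE (a b : R) p : (`[- a, b] `*` `[- b, +oo[)%classic p <->
    (p.1 \in `[- a, b]) && (p.2 \in `[- b, +oo[).
  by split => [[/= -> ->//]|/andP[]].
split.
- by move=> p /toE; rewrite -F3_strip => /toE.
- by move=> p q _ _; exact: (can_inj F3_involutive).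
- move=> p /toE; rewrite -F3_strip => /toE Fp.
  by exists (F3 p) => //; exact: F3_involutive.
Qed.

Lemma F3_sum {R : realType} (p : R * R) : (F3 p).1 + (F3 p).2 = p.1 + p.2.
Proof. by rewrite /F3/=; ring. Qed.

Lemma continuous_F3 {R : realType} : continuous (@F3 R).
Proof.
have cm : continuous (fun p : R * R => Num.min (- p.1) p.2).
  move=> p; apply: (@continuous_min _ _ (fun p : R * R => - p.1) snd).
    by apply: cvgN; exact: cvg_fst.
  exact: cvg_snd.
move=> p; apply: (@cvg_pair _ _ _ _ (nbhs (F3 p).1) (nbhs (F3 p).2)).
  exact: cm.
apply: cvgB; last exact: cm.
by apply: cvgD; [exact: cvg_snd|exact: cvg_fst].
Qed.

Lemma measurable_F3 {R : realType} : measurable_fun setT (@F3 R).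
Proof.
have mm : measurable_fun setT (fun p : R * R => Num.min (- p.1) p.2).
  by apply: measurable_minr; [exact: measurable_funN|].
apply: measurable_fun_pair => //; apply: measurable_funB => //.
exact: measurable_funD.
Qed.

(** * Invariance of the planar Lebesgue measure *)

Section lebesgue_invariance.
Context {R : realType}.
Local Open Scope ereal_scope.
Implicit Type g : R -> \bar R.

(** The pushforward of Lebesgue measure under a reflection gives half-open
intervals their length, and that characterizes Lebesgue measure. *)
Lemma ge0_integral_reflect (a : R) g : measurable_fun setT g ->
  (forall x, 0 <= g x) ->
  \int[leb]_x g (a - x)%R = \int[leb]_x g x.
Proof.
move=> mg g0.
have mr : measurable_fun setT
    ((fun x => a - x)%R : measurableTypeR R -> measurableTypeR R).
  exact: measurable_funB.
rewrite -[LHS](@ge0_integral_pushforward _ _ _ _ _ _ mr leb setT g)//.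
apply: eq_measure_integral => A mA _; apply/esym.
apply: (@lebesgue_measure_unique R (pushforward leb _)) => //= _ [[c d]] _ <-.
rewrite /pushforward.
rewrite (_ : _ @^-1` _ = `[a - d, a - c[%classic)%R.
  rewrite !lebesgue_measure_itv/= !lte_fin ltrD2l ltrN2.
  by case: ifP => // _; rewrite -!EFinB; congr (_%:E); ring.
by apply/seteqP; split => x/=; rewrite !in_itv/= => /andP[? ?]; apply/andP;
  split; lra.
Qed.

(** A translation is the composite of two reflections. *)
Lemma ge0_integral_shift (a : R) g : measurable_fun setT g ->
  (forall x, 0 <= g x) ->
  \int[leb]_x g (x + a)%R = \int[leb]_x g x.
Proof.
move=> mg g0; rewrite -[RHS](ge0_integral_reflect a)//.
rewrite -[RHS](ge0_integral_reflect 0)//.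
- by apply: eq_integral => x _; rewrite sub0r opprK addrC.
- by apply: measurableT_comp => //; exact: measurable_funB.
Qed.

End lebesgue_invariance.

Lemma tonelli_xy {R : realType} (G : R * R -> \bar R) :
  measurable_fun setT G -> (forall p, 0 <= G p)%E ->
  (\int[leb \x leb]_p G p = \int[leb]_x \int[leb]_y G (x, y))%E.
Proof.
exact: (@fubini_tonelli1 _ _ (measurableTypeR R) (measurableTypeR R) R leb leb).
Qed.

Lemma tonelli_yx {R : realType} (G : R * R -> \bar R) :
  measurable_fun setT G -> (forall p, 0 <= G p)%E ->
  (\int[leb \x leb]_p G p = \int[leb]_y \int[leb]_x G (x, y))%E.
Proof.
exact: (@fubini_tonelli2 _ _ (measurableTypeR R) (measurableTypeR R) R leb leb).
Qed.

(** By Tonelli: for fixed x substitute s = x + y, for fixed s reflect x into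
u = min 0 s - x, and for fixed u substitute v = s - u. *)
Lemma ge0_integral_F3 {R : realType} (G : R * R -> \bar R) :
  measurable_fun setT G -> (forall p, 0 <= G p)%E ->
  (\int[leb \x leb]_p G (F3 p) = \int[leb \x leb]_p G p)%E.
Proof.
move=> mG G0.
have mGF : measurable_fun setT (G \o F3).
  exact: measurableT_comp mG measurable_F3.
pose m (s : R) := Num.min 0 s.
have mm : measurable_fun setT m by exact: measurable_minr.
(* H is G in the coordinates (u, s), and K is G \o F3 in the coordinates
   (x, s). *)
pose H (p : R * R) := G (p.1, p.2 - p.1).
pose K (p : R * R) := G (m p.2 - p.1, p.2 - (m p.2 - p.1)).
have mH : measurable_fun setT H.
  apply: measurableT_comp mG _; apply: measurable_fun_pair => //.
  exact: measurable_funB.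
have mK : measurable_fun setT K.
  have mK1 : measurable_fun setT (fun p : R * R => m p.2 - p.1).
    by apply: measurable_funB => //; exact: measurableT_comp.
  apply: measurableT_comp mG _; apply: measurable_fun_pair => //.
  exact: measurable_funB.
have H0 p : (0 <= H p)%E by exact: G0.
have GF0 p : (0 <= (G \o F3) p)%E by exact: G0.
have K0 p : (0 <= K p)%E by exact: G0.
transitivity (\int[leb]_x \int[leb]_s K (x, s))%E.
  apply: etrans (tonelli_xy mGF GF0) _; apply: eq_integral => x _.
  rewrite -[RHS](ge0_integral_shift x)//.
  - by apply: eq_integral => y _; rewrite /= F3_shear.
  - exact: measurableT_comp mK (pair1_measurable x).
transitivity (\int[leb]_x \int[leb]_s H (x, s))%E.
  rewrite -(tonelli_xy mK K0) -(tonelli_xy mH H0).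
  rewrite (tonelli_yx mK K0) (tonelli_yx mH H0).
  apply: eq_integral => s _.
  rewrite -[RHS](ge0_integral_reflect (m s))//.
  exact: measurableT_comp mH (pair2_measurable s).
rewrite (tonelli_xy mG G0); apply: eq_integral => u _.
rewrite -[RHS](ge0_integral_shift (- u))//.
exact: measurableT_comp mG (pair1_measurable u).
Qed.

(** * Joint densities *)

Section density_measure.
Context d (T : measurableType d) (R : realType).
Variables (mu : {measure set T -> \bar R}) (f : T -> \bar R).
Hypotheses (mf : measurable_fun setT f) (f0 : forall x, (0 <= f x)%E).

Definition density_measure (A : set T) : \bar R := (\int[mu]_(x in A) f x)%E.

Let density0 : density_measure set0 = 0%E.
Proof. by rewrite /density_measure integral_set0. Qed.

Let density_ge0 A : (0 <= density_measure A)%E.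
Proof. exact: integral_ge0. Qed.

Let density_sigma_additive : semi_sigma_additive density_measure.
Proof.
move=> /= F mF tF mUF; rewrite /density_measure; apply: cvg_toP.
  apply: ereal_nondecreasing_is_cvgn => m n mn.
  by apply: lee_sum_nneg_natr => // k _ _; exact: integral_ge0.
by rewrite ge0_integral_bigcup//; exact: measurable_funTS.
Qed.

HB.instance Definition _ := isMeasure.Build _ _ _
  density_measure density0 density_ge0 density_sigma_additive.

Definition measure_of_density : {measure set T -> \bar R} := density_measure.

End density_measure.

Definition tensor {R : realType} (f h : R -> R) (p : R * R) : R :=
  f p.1 * h p.2.

Section tensor.
Context {R : realType} (f h : R -> R).
Hypotheses (mf : measurable_fun setT f) (mh : measurable_fun setT h).
Hypotheses (f0 : forall x, 0 <= f x) (h0 : forall x, 0 <= h x).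

Lemma tensor_ge0 p : 0 <= tensor f h p.
Proof. exact: mulr_ge0. Qed.

Lemma measurable_tensor : measurable_fun setT (tensor f h).
Proof.
by apply: measurable_funM; [exact: measurableT_comp mf measurable_fst|
  exact: measurableT_comp mh measurable_snd].
Qed.

Lemma integral_tensor :
  (\int[leb \x leb]_p (tensor f h p)%:E =
   (\int[leb]_x (f x)%:E) * (\int[leb]_y (h y)%:E))%E.
Proof.
have mE : measurable_fun setT (fun p => (tensor f h p)%:E).
  by apply/measurable_EFinP; exact: measurable_tensor.
have E0 p : (0 <= (tensor f h p)%:E)%E by rewrite lee_fin tensor_ge0.
rewrite (tonelli_xy mE E0).
transitivity (\int[leb]_x ((f x)%:E * \int[leb]_y (h y)%:E))%E.
  apply: eq_integral => x _.
  rewrite -ge0_integralZl//.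
  - exact/measurable_EFinP.
  - by move=> y _; rewrite lee_fin.
  - by rewrite lee_fin.
rewrite ge0_integralZr//.
- exact/measurable_EFinP.
- by move=> y _; rewrite lee_fin.
by apply: integral_ge0 => y _; rewrite lee_fin.
Qed.

End tensor.

Lemma integral_tensorX {R : realType} (f h : R -> R) (A B : set R) :
  measurable_fun setT f -> measurable_fun setT h ->
  (forall x, 0 <= f x) -> (forall x, 0 <= h x) ->
  measurable A -> measurable B ->
  (\int[leb \x leb]_(p in A `*` B) (tensor f h p)%:E =
   (\int[leb]_(x in A) (f x)%:E) * (\int[leb]_(y in B) (h y)%:E))%E.
Proof.
move=> mf mh f0 h0 mA mB.
have fA0 x : 0 <= (f \_ A) x by rewrite patchE; case: ifP.
have hB0 x : 0 <= (h \_ B) x by rewrite patchE; case: ifP.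
have mfA : measurable_fun setT (f \_ A).
  by apply/(measurable_restrictT _ mA); exact: measurable_funTS.
have mhB : measurable_fun setT (h \_ B).
  by apply/(measurable_restrictT _ mB); exact: measurable_funTS.
rewrite integral_mkcond [X in (X * _)%E]integral_mkcond.
rewrite [X in (_ * X)%E]integral_mkcond !restrict_EFin.
rewrite -(integral_tensor mfA mhB fA0 hB0).
apply: eq_integral => -[x y] _; congr (_%:E).
rewrite /tensor/= !patchE in_setX/=.
by case: (x \in A); case: (y \in B); rewrite /= ?mulr0 ?mul0r.
Qed.

(** Two measures that give each rectangle A `*` B the mass
P (X in A) * P (Y in B) coincide: one is the law of (X, Y), the other one has
the product density. *)
Lemma joint_density d (T : measurableType d) (R : realType)
    (P : probability T R) (X Y : {RV P >-> R}) (f h : R -> R) :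
  independent_rv P X Y ->
  has_density (distribution P X) f -> has_density (distribution P Y) h ->
  forall S : set (R * R), measurable S ->
    P ((fun w => (X w, Y w)) @^-1` S) =
    (\int[leb \x leb]_(p in S) (tensor f h p)%:E)%E.
Proof.
move=> iXY [mf f0 Xf] [mh h0 Yh] S mS.
have mE : measurable_fun setT (fun p => (tensor f h p)%:E).
  by apply/measurable_EFinP; exact: measurable_tensor.
have E0 p : (0 <= (tensor f h p)%:E)%E by rewrite lee_fin tensor_ge0.
(* Lebesgue measure is declared on the type measurableTypeR R, which has the
   measurable sets of R but another measurable structure; X and Y are retyped
   accordingly for the products of measures to match. *)
pose RM := measurableTypeR R.
pose X' : {mfun T >-> RM} := HB.pack (X : T -> RM)
  (isMeasurableFun.Build _ _ T RM X (measurable_funP X)).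
pose Y' : {mfun T >-> RM} := HB.pack (Y : T -> RM)
  (isMeasurableFun.Build _ _ T RM Y (measurable_funP Y)).
pose mu : {measure set (RM * RM) -> \bar R} :=
  measure_of_density (leb \x leb)%E mE E0.
have muE A B : measurable A -> measurable B ->
    mu (A `*` B) = (distribution P X' A * distribution P Y' B)%E.
  move=> mA mB; apply: etrans (integral_tensorX mf mh f0 h0 mA mB) _.
  by congr (_ * _)%E; apply/esym; [exact: Xf|exact: Yh].
have mXY : measurable_fun setT (fun w => (X' w, Y' w)).
  exact: measurable_fun_pair.
transitivity ((distribution P X' \x distribution P Y')%E S).
  apply/esym.
  apply: (@product_measure_unique _ _ RM RM R (distribution P X')
    (distribution P Y') (pushforward P _)) => //.
rewrite -[RHS]/(mu S).
exact: (@product_measure_unique _ _ RM RM R (distribution P X')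
  (distribution P Y') mu muE S mS).
Qed.

(** The event F3 (X, Y) in S is (X, Y) in the preimage of S; the change of
variables has Jacobian 1 and F3 is its own inverse. *)
Lemma joint_density_F3 d (T : measurableType d) (R : realType)
    (P : probability T R) (X Y : {RV P >-> R}) (f h : R -> R) :
  independent_rv P X Y ->
  has_density (distribution P X) f -> has_density (distribution P Y) h ->
  forall S : set (R * R), measurable S ->
    P ((fun w => F3 (X w, Y w)) @^-1` S) =
    (\int[leb \x leb]_(p in S) (tensor f h (F3 p))%:E)%E.
Proof.
move=> iXY dX dY S mS.
have [mf f0 _] := dX; have [mh h0 _] := dY.
have mFS : measurable (F3 @^-1` S : set (R * R)).
  by rewrite -[X in measurable X]setTI; exact: measurable_F3.
rewrite -[LHS]/(P ((fun w => (X w, Y w)) @^-1` (F3 @^-1` S))).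
rewrite (joint_density iXY dX dY mFS).
rewrite integral_mkcond [RHS]integral_mkcond.
have mG : measurable_fun setT
    ((fun p => (tensor f h (F3 p))%:E) \_ S).
  apply/(measurable_restrictT _ mS); apply: measurable_funTS.
  apply/measurable_EFinP.
  exact: measurableT_comp (measurable_tensor mf mh) measurable_F3.
rewrite -(ge0_integral_F3 mG).
  apply: eq_integral => p _; rewrite !patchE F3_involutive.
  by have -> : (p \in F3 @^-1` S) = (F3 p \in S) by apply/idP/idP; rewrite !inE.
by move=> p; rewrite patchE; case: ifP => // _; rewrite lee_fin tensor_ge0.
Qed.

Lemma F3_pairE {S : Type} {R : realType} (X Y : S -> R) :
  (fun w => ((F3 (X w, Y w)).1, (F3 (X w, Y w)).2)) =
  (fun w => F3 (X w, Y w)).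
Proof. by apply/funext => w; rewrite -surjective_pairing. Qed.

(** * Independence as a pointwise identity between densities *)

Definition box {R : realType} (p : R * R) (e : R) : set (R * R) :=
  `[p.1 - e, p.1 + e] `*` `[p.2 - e, p.2 + e].

Lemma measurable_box {R : realType} (p : R * R) e : measurable (box p e).
Proof. by apply: measurableX; exact: measurable_itv. Qed.

Lemma integral_box_cst {R : realType} (p : R * R) (e k : R) : 0 < e ->
  (\int[leb \x leb]_(q in box p e) k%:E = (k * (2 * e) ^+ 2)%:E)%E.
Proof.
move=> e0.
have side (a : R) : leb `[a - e, a + e]%classic = (2 * e)%:E.
  rewrite lebesgue_measure_itv/= lte_fin ifT; last by lra.
  by rewrite -EFinB; congr (_%:E); ring.
have mbox := @measurable_box R p e.
rewrite integral_cst// [X in (_ * X)%E](_ : _ = ((2 * e) ^+ 2)%:E)//.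
pose side_itv (a : R) := `[a - e, a + e]%classic.
transitivity (leb (side_itv p.1) * leb (side_itv p.2))%E.
  by apply: product_measure1E; exact: measurable_itv.
by rewrite !side -!EFinM expr2.
Qed.

(** Lebesgue differentiation at a point of continuity. The mean is squeezed
between g p - k and g p + k; the lower bound is stated with k on the other side
so that only integrals of nonnegative functions occur, g p - k being possibly
negative. *)
Lemma box_average {R : realType} (g : R * R -> R) (p : R * R) :
  measurable_fun setT g -> (forall q, 0 <= g q) -> {for p, continuous g} ->
  fine (\int[leb \x leb]_(q in box p e) (g q)%:E)%E / (2 * e) ^+ 2
    @[e --> 0^'+] --> g p.
Proof.
move=> mg g0 cg; apply/cvgrPdist_le => k k0.
have /cvgrPdist_le/(_ k k0)/nbhs_ballP[r /= r0 rB] := cg.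
near=> e.
have er : e < r by near: e; exact: nbhs_right_lt.
have e0 : 0 < e by near: e; exact: nbhs_right_gt.
have e2 : 0 < (2 * e) ^+ 2 by rewrite exprn_gt0// mulr_gt0.
have gk q : box p e q -> `|g p - g q| <= k.
  case=> /=; rewrite !in_itv/= => /andP[? ?] /andP[? ?].
  by apply: rB; split => /=; rewrite /ball/= ltr_norml; apply/andP; split; lra.
have mB := @measurable_box R p e.
have mE (h : R * R -> R) : measurable_fun setT h ->
    measurable_fun (box p e) (fun q => (h q)%:E).
  by move=> mh; apply/measurable_EFinP; exact: measurable_funTS.
set I := (\int[_]_(_ in _) _)%E.
have I0 : (0 <= I)%E by apply: integral_ge0 => q _; rewrite lee_fin.
have Iu : (I <= ((g p + k) * (2 * e) ^+ 2)%:E)%E.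
  rewrite -(integral_box_cst p _ e0); apply: ge0_le_integral => //.
  - by move=> q _; rewrite lee_fin.
  - exact: mE.
  - by move=> q /gk; rewrite lee_fin ler_norml => /andP[? ?]; lra.
have Il : ((g p * (2 * e) ^+ 2)%:E <= I + (k * (2 * e) ^+ 2)%:E)%E.
  rewrite -!(integral_box_cst p _ e0) -ge0_integralD//; last 3 first.
  - by move=> q _; rewrite lee_fin.
  - exact: mE.
  - by move=> q _; rewrite lee_fin ltW.
  apply: ge0_le_integral => //.
  - by move=> q _; rewrite lee_fin.
  - by apply: emeasurable_funD => //; exact: mE.
  - by move=> q /gk; rewrite -EFinD lee_fin ler_norml => /andP[? ?]; lra.
have If : I \is a fin_num by rewrite ge0_fin_numE// (le_lt_trans Iu)// ltry.
move: Iu Il; rewrite -(fineK If) -EFinD !lee_fin => Iu Il.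
rewrite ler_norml; apply/andP; split.
  by rewrite lerBrDr addrC lerBlDr ler_pdivrMr// addrC.
by rewrite lerBlDr -lerBlDl ler_pdivlMr// mulrBl lerBlDr.
Unshelve. all: by end_near. Qed.

(** Independence makes the mass of the square of side 2 e centred at (a, b) a
product F U a e * F V b e, and the identity holds for every such product; it
survives the limit e --> 0. *)
Lemma independent_density_rank1 d (T : measurableType d) (R : realType)
    (P : probability T R) (U V : T -> R) (g : R * R -> R) :
  measurable_fun setT g -> (forall q, 0 <= g q) ->
  (forall S : set (R * R), measurable S ->
    P ((fun w => (U w, V w)) @^-1` S) =
    (\int[leb \x leb]_(q in S) (g q)%:E)%E) ->
  measurable_fun setT U -> measurable_fun setT V -> independent_rv P U V ->
  forall u v u' v',
  {for (u, v), continuous g} -> {for (u', v'), continuous g} ->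
  {for (u, v'), continuous g} -> {for (u', v), continuous g} ->
  g (u, v) * g (u', v') = g (u, v') * g (u', v).
Proof.
move=> mg g0 gUV mU mV iUV u v u' v' c1 c2 c3 c4.
pose N (p : R * R) e :=
  fine (\int[leb \x leb]_(q in box p e) (g q)%:E)%E / (2 * e) ^+ 2.
have N_cvg p : {for p, continuous g} -> N p e @[e --> 0^'+] --> g p.
  exact: box_average.
pose B (a e : R) := `[a - e, a + e]%classic.
pose F (W : T -> R) a (e : R) := fine (P (W @^-1` B a e)) / (2 * e).
have finP (W : T -> R) a e : measurable_fun setT W ->
    P (W @^-1` B a e) \is a fin_num.
  move=> mW; apply: fin_num_measure; rewrite -[X in measurable X]setTI.
  by apply: mW => //; exact: measurable_itv.
have NE a b e : N (a, b) e = F U a e * F V b e.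
  rewrite /N -gUV; last exact: measurable_box.
  have -> : P ((fun w => (U w, V w)) @^-1` box (a, b) e) =
      (P (U @^-1` B a e) * P (V @^-1` B b e))%E.
    by rewrite -iUV//; exact: measurable_itv.
  by rewrite fineM ?finP// /F expr2 invfM mulrACA.
have L1 : N (u, v) e * N (u', v') e @[e --> 0^'+] --> g (u, v) * g (u', v').
  by apply: cvgM; exact: N_cvg.
have L2 : N (u, v) e * N (u', v') e @[e --> 0^'+] --> g (u, v') * g (u', v).
  under eq_cvg do rewrite !NE mulrACA [F V v _ * _]mulrC mulrACA -!NE.
  by apply: cvgM; exact: N_cvg.
exact: (norm_cvg_unique L1 L2).
Qed.

(** * The functional equation *)

Lemma is_derive_addl {R : realType} (F : R -> R) (a D : R) :
  is_derive a 1 F D -> is_derive (0 : R) 1 (fun t => F (a + t)) D.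
Proof.
move=> FD.
have FD' : is_derive (shift a (0 : R)) 1 F D by rewrite /shift/= add0r.
have := @is_derive1_comp _ F (shift a) 0 _ _ FD' (is_derive_shift 0 1 a).
rewrite mulr1; congr is_derive.
by apply/funext => t /=; rewrite addrC.
Qed.

(** Comparing at 0 the values and the derivatives of the two sides, and
dividing, eliminates the constants k and l. *)
Lemma log_derivative_eq {R : realType} (F H : R -> R) (a b k l DF DH : R) :
  k != 0 -> 0 < F a -> 0 < H b ->
  is_derive a 1 F DF -> is_derive b 1 H DH ->
  (\forall t \near (0 : R), k * F (a + t) = l * H (b + t)) ->
  DF / F a = DH / H b.
Proof.
move=> k0 Fa Hb dF dH kl.
have dkF : is_derive (0 : R) 1 (fun t => k * F (a + t)) (k * DF).
  by have := is_deriveZ k (is_derive_addl dF).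
have dlH : is_derive (0 : R) 1 (fun t => l * H (b + t)) (l * DH).
  by have := is_deriveZ l (is_derive_addl dH).
have kl0 : k * F a = l * H b by have := nbhs_singleton kl; rewrite !addr0.
have kldD : k * DF = l * DH.
  have [_ <-] := dlH; have [_ <-] := near_eq_is_derive kl dkF; by [].
apply/eqP; rewrite eqr_div ?lt0r_neq0//; apply/eqP; apply: (mulfI k0).
by rewrite mulrA kldD mulrCA kl0; ring.
Qed.

(** The derivative of f y * exp (la * y) vanishes. *)
Lemma constant_log_derivative {R : realType} (f df : R -> R) (la : R)
    (i : interval R) :
  (forall x, x \in i -> 0 < f x) ->
  (forall x, x \in i -> is_derive x 1 f (df x)) ->
  (forall x, x \in i -> df x / f x = - la) ->
  forall x y, x \in i -> y \in i -> f y * expR (la * y) = f x * expR (la * x).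
Proof.
move=> f0 fd fla.
wlog suff H : / forall x y, x <= y -> x \in i -> y \in i ->
    f y * expR (la * y) = f x * expR (la * x).
  move=> x y xi yi; have [xy|/ltW yx] := leP x y; first exact: H.
  by apply/esym; exact: H.
move=> x y xy xi yi.
have sub z : z \in `[x, y] -> z \in i.
  by rewrite in_itv/= => xzy; exact: (@interval_is_interval _ i x y).
pose p z := f z * expR (la * z).
have pd z : z \in i -> is_derive z 1 p 0.
  move=> zi.
  have dl : is_derive z 1 (fun z : R => la * z) la.
    have := is_deriveZ la (is_derive_id z 1).
    by rewrite /= /GRing.scale/= mulr1.
  have de : is_derive z 1 (fun z => expR (la * z)) (expR (la * z) * la).
    exact: is_derive1_comp.
  apply: (@is_derive_eq _ _ _ p z 1 _ _ (is_deriveM (fd z zi) de)).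
  have := fla z zi => /(canRL (divfK (lt0r_neq0 (f0 z zi)))) ->.
  by rewrite /GRing.scale/=; ring.
have [||c _] := @MVT_segment R p (cst 0) x y xy.
- by move=> z zxy; apply: pd; apply: sub; exact: subset_itv_oo_cc zxy.
- apply: derivable_within_continuous => z zxy.
  by have [] := pd z (sub z zxy).
by rewrite mul0r => /eqP; rewrite subr_eq0 => /eqP.
Qed.

(** The core of the characterization, which turns the product identity into a
common constant logarithmic derivative of f and h. *)
Lemma rank1_exponential {R : realType} (c1 c2 : R) (f h df dh : R -> R) :
  0 < c1 -> 0 < c2 ->
  (forall x, x \in `]- c1, c2[ -> 0 < f x) ->
  (forall y, y \in `]- c2, +oo[ -> 0 < h y) ->
  (forall x, x \in `]- c1, c2[ -> is_derive x 1 f (df x)) ->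
  (forall y, y \in `]- c2, +oo[ -> is_derive y 1 h (dh y)) ->
  (forall u v u' v', u \in `]- c2, c1[ -> v \in `]- c1, +oo[ ->
    u' \in `]- c2, c1[ -> v' \in `]- c1, +oo[ ->
    tensor f h (F3 (u, v)) * tensor f h (F3 (u', v')) =
    tensor f h (F3 (u, v')) * tensor f h (F3 (u', v))) ->
  exists la : R,
    (forall x, x \in `]- c1, c2[ -> f x = f 0 * expR (- la * x)) /\
    (forall y, y \in `]- c2, +oo[ -> h y = h 0 * expR (- la * y)).
Proof.
move=> c1_gt0 c2_gt0 f0 h0 fd hd rank1.
(* Of the four points (-x, v), (-v, x), (-x, x) and (-v, v), only the first one
   may lie strictly above the line u + v = 0. *)
have E1 x v : - c1 < x -> x <= v -> v < c2 ->
    h (- x) * f v = f x * h (v - 2 * x).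
  move=> c1x xv vc2.
  have := rank1 (- x) v (- v) x.
  rewrite !in_itv/= !andbT.
  move=> /(_ ltac:(lra) ltac:(lra) ltac:(lra) ltac:(lra)).
  rewrite (F3_above (u := - x) (v := v)); last by lra.
  rewrite !F3_below; try by lra.
  rewrite /tensor/= opprK mulrN => E.
  have fx : f x != 0 by rewrite lt0r_neq0// f0// in_itv/=; lra.
  have hv : h (- v) != 0 by rewrite lt0r_neq0// h0// in_itv/= andbT; lra.
  apply: (mulfI fx); apply: (mulIf hv).
  by apply: (etrans (etrans _ (esym E))); ring.
(* All four points are in the half-plane u + v >= 0. *)
have E2 y t : c2 <= y -> - (2 * c2) < t -> t < 2 * c1 ->
    h (c2 + t) * h y = h (y + t) * h c2.
  move=> c2y tl tu.
  have := rank1 (t / 2) y 0 c2.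
  rewrite !in_itv/= !andbT => /(_ ltac:(lra) ltac:(lra) ltac:(lra) ltac:(lra)).
  rewrite !F3_above; try by lra.
  have -> : 2 * (t / 2) = t by field.
  rewrite /tensor/= mulr0 oppr0 !addr0 => E.
  have ft : f (- (t / 2)) != 0 by rewrite lt0r_neq0// f0// in_itv/=; lra.
  have f00 : f 0 != 0 by rewrite lt0r_neq0// f0// in_itv/=; lra.
  apply: (mulfI ft); apply: (mulIf f00); apply/esym.
  by apply: (etrans (etrans _ E)); ring.
have L1 x v : - c1 < x -> x < v -> v < c2 ->
    df v / f v = dh (v - 2 * x) / h (v - 2 * x).
  move=> c1x xv vc2.
  apply: (@log_derivative_eq R f h v (v - 2 * x) (h (- x)) (f x)).
  - by rewrite lt0r_neq0// h0// in_itv/= andbT; lra.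
  - by rewrite f0// in_itv/=; lra.
  - by rewrite h0// in_itv/= andbT; lra.
  - by apply: fd; rewrite in_itv/=; lra.
  - by apply: hd; rewrite in_itv/= andbT; lra.
  near=> t.
  have t1 : t < c2 - v by near: t; apply: lt_nbhsl; lra.
  have t2 : x - v < t by near: t; apply: lt_nbhsr; lra.
  by rewrite addrAC E1//; lra.
have L2 y : c2 <= y -> dh y / h y = dh c2 / h c2.
  move=> c2y; apply: (@log_derivative_eq R h h y c2 (h c2) (h y)).
  - by rewrite lt0r_neq0// h0// in_itv/= andbT; lra.
  - by rewrite h0// in_itv/= andbT; lra.
  - by rewrite h0// in_itv/= andbT; lra.
  - by apply: hd; rewrite in_itv/= andbT; lra.
  - by apply: hd; rewrite in_itv/= andbT; lra.
  near=> t.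
  rewrite mulrC -E2//; first by rewrite mulrC.
  - by near: t; apply: lt_nbhsr; lra.
  - by near: t; apply: lt_nbhsl; lra.
(* c1 belongs to ]- v, v + 2 * c1[ for every v in ]- c1, c2[. *)
pose la := - (dh c1 / h c1).
have Lf v : v \in `]- c1, c2[ -> df v / f v = - la.
  rewrite in_itv/= => /andP[? ?].
  rewrite (L1 ((v - c1) / 2)); [|lra..].
  by rewrite /la opprK; have -> : v - 2 * ((v - c1) / 2) = c1 by field.
have Lh_low y : - c2 < y -> y < c2 + 2 * c1 -> dh y / h y = - la.
  move=> yl yu.
  (* v is chosen in ]- c1, c2[ so that y lies in ]- v, v + 2 * c1[. *)
  pose m := Num.max (- c1) (Num.max (- y) (y - 2 * c1)).
  have [m1 m2 m3] : [/\ - c1 <= m, - y <= m & y - 2 * c1 <= m].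
    by rewrite /m !le_max !lexx ?orbT.
  have mc2 : m < c2 by rewrite /m !gt_max; apply/and3P; split; lra.
  pose v := (c2 + m) / 2.
  have mv : m < v by rewrite /v; lra.
  have vc : v < c2 by rewrite /v; lra.
  rewrite -(Lf v); last by rewrite in_itv/=; lra.
  rewrite (L1 ((v - y) / 2)); [|lra..].
  by have -> : v - 2 * ((v - y) / 2) = y by field.
have Lh y : y \in `]- c2, +oo[ -> dh y / h y = - la.
  rewrite in_itv/= andbT => yl.
  have [yu|yu] := ltP y (c2 + 2 * c1); first exact: Lh_low.
  by rewrite L2; [apply: Lh_low; lra|lra].
have expE (a b z : R) : a * expR (la * z) = b -> a = b * expR (- la * z).
  by move=> <-; rewrite -mulrA -expRD -mulrDl subrr mul0r expR0 mulr1.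
exists la; split => z zi; apply: expE.
- rewrite (constant_log_derivative f0 fd Lf (x := 0))//.
    by rewrite mulr0 expR0 mulr1.
  by rewrite in_itv/=; lra.
- rewrite (constant_log_derivative h0 hd Lh (x := 0))//.
    by rewrite mulr0 expR0 mulr1.
  by rewrite in_itv/= andbT; lra.
Unshelve. all: by end_near. Qed.

(** * Exponential densities *)

Section exponential_mass.
Context {R : realType}.
Variables (la : R).
Hypothesis la_gt0 : 0 < la.

Let E (x : R) : R := expR (- la * x).
Let F (x : R) : R := - (la^-1 * expR (- la * x)).

Let dF (x : R) : is_derive x 1 F (E x).
Proof.
have dl : is_derive x 1 (fun z : R => - la * z) (- la).
  have := is_deriveZ (- la) (is_derive_id x 1).
  by rewrite /= /GRing.scale/= mulr1.
have de : is_derive x 1 (fun z => expR (- la * z)) (expR (- la * x) * - la).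
  exact: is_derive1_comp.
apply: (@is_derive_eq _ _ _ F x 1 _ _ (is_deriveN (is_deriveZ la^-1 de))).
by rewrite /GRing.scale/= /E; field; rewrite gt_eqF.
Qed.

Let cF : continuous F.
Proof.
by move=> x; apply/differentiable_continuous/derivable1_diffP; have [] := dF x.
Qed.

Lemma continuous_expRM : continuous E.
Proof.
move=> x; apply: continuous_comp; last exact: continuous_expR.
exact: mulrl_continuous.
Qed.

Lemma measurable_expRM : measurable_fun setT E.
Proof. exact: continuous_measurable_fun continuous_expRM. Qed.

Lemma integral_expR_itv (a b : R) : a < b ->
  (\int[leb]_(x in `[a, b]) (expR (- la * x))%:E =
   (la^-1 * (expR (- la * a) - expR (- la * b)))%:E)%E.
Proof.
move=> ab; rewrite (@continuous_FTC2 _ E F a b)//.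
- by rewrite -EFinB /F; congr (_%:E); ring.
- by apply: continuous_subspaceT; exact: continuous_expRM.
- split; first by move=> x _; have [] := dF x.
  + by apply: cvg_at_right_filter; exact: cF.
  + by apply: cvg_at_left_filter; exact: cF.
- by move=> x _; rewrite derive1E; have [_ ->] := dF x.
Qed.

Lemma integral_expR_itvy (a : R) :
  (\int[leb]_(x in `[a, +oo[) (expR (- la * x))%:E =
   (la^-1 * expR (- la * a))%:E)%E.
Proof.
rewrite (@ge0_continuous_FTC2y _ E F a 0)//.
- by rewrite -EFinB /F; congr (_%:E); ring.
- by move=> x _; exact: expR_ge0.
- by apply: continuous_subspaceT; exact: continuous_expRM.
- have Ey : E x @[x --> +oo] --> 0.
    have -> : E = (fun z => expR (- z)) \o (fun z => la * z).
      by apply/funext => x /=; rewrite /E mulNr.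
    apply: (@cvg_comp _ _ _ (fun z => la * z) (fun z => expR (- z)) _
      (pinfty_nbhs R)); last exact: cvgr_expR.
    exact: gt0_cvgMry.
  by rewrite -oppr0 -(mulr0 la^-1); apply: cvgN; apply: cvgMr Ey.
- by apply: cvg_at_right_filter; exact: cF.
- by move=> x _; rewrite derive1E; have [_ ->] := dF x.
Qed.

Lemma stExp_pdfE (d1 d2 : R) : stExp_pdf la d1 d2 =
  (fun x => (la^-1 * (expR (- la * d1) - expR (- la * d2)))^-1 *
     expR (- la * x)) \_ `[d1, d2].
Proof.
apply/funext => x; rewrite /stExp_pdf/= patchE indicE.
by case: (x \in _); rewrite ?mulr1 ?mulr0.
Qed.

Lemma sExp_pdfE (c : R) : sExp_pdf la c =
  (fun x => (la^-1 * expR (- la * c))^-1 * expR (- la * x)) \_ `[c, +oo[.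
Proof.
apply/funext => x; rewrite /sExp_pdf/= patchE indicE.
by case: (x \in _); rewrite ?mulr1 ?mulr0.
Qed.

Lemma normalizer_gt0 (d1 d2 : R) : d1 < d2 ->
  0 < la^-1 * (expR (- la * d1) - expR (- la * d2)).
Proof.
move=> d12; rewrite mulr_gt0 ?invr_gt0// subr_gt0 ltr_expR.
by rewrite !mulNr ltrN2 ltr_pM2l.
Qed.

Lemma stExp_pdf_ge0 (d1 d2 : R) : d1 < d2 ->
  forall x, 0 <= stExp_pdf la d1 d2 x.
Proof.
move=> d12 x; rewrite stExp_pdfE patchE; case: ifP => // _.
by rewrite mulr_ge0 ?expR_ge0// invr_ge0 ltW// normalizer_gt0.
Qed.

Lemma sExp_pdf_ge0 (c x : R) : 0 <= sExp_pdf la c x.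
Proof.
rewrite sExp_pdfE patchE; case: ifP => // _.
by rewrite mulr_ge0 ?expR_ge0// invr_ge0 mulr_ge0 ?expR_ge0// invr_ge0 ltW.
Qed.

Let measurable_scaled_expR (k : R) (i : interval R) :
  measurable_fun setT ((fun x => k * expR (- la * x)) \_ [set` i]).
Proof.
apply/(measurable_restrictT _ (measurable_itv i)); apply: measurable_funTS.
by apply: (@measurable_funM _ _ _ _ (cst k) E) => //; exact: measurable_expRM.
Qed.

Lemma measurable_stExp_pdf (d1 d2 : R) :
  measurable_fun setT (stExp_pdf la d1 d2).
Proof. by rewrite stExp_pdfE; exact: measurable_scaled_expR. Qed.

Lemma measurable_sExp_pdf (c : R) : measurable_fun setT (sExp_pdf la c).
Proof. by rewrite sExp_pdfE; exact: measurable_scaled_expR. Qed.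

Lemma integral_restrict_expR (A D : set R) (k : R) : measurable A ->
  measurable D -> 0 <= k ->
  (\int[leb]_(x in A) (((fun x => k * expR (- la * x)) \_ D) x)%:E =
   k%:E * \int[leb]_(x in A `&` D) (expR (- la * x))%:E)%E.
Proof.
move=> mA mD k0.
rewrite -ge0_integralZl//.
- rewrite integral_mkcondr; apply: eq_integral => x _.
  by rewrite !patchE; case: ifP.
- exact: measurableI.
- by apply/measurable_EFinP; apply: measurable_funTS; exact: measurable_expRM.
Qed.

Lemma stExpE (d1 d2 a b : R) (A : set R) : d1 < d2 -> a < b ->
  measurable A -> A `&` `[d1, d2] = `[a, b]%classic ->
  stExp la d1 d2 A = ((expR (- la * a) - expR (- la * b)) /
                      (expR (- la * d1) - expR (- la * d2)))%:E.
Proof.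
move=> d12 ab mA AI; have := normalizer_gt0 d12 => Z0.
rewrite /stExp stExp_pdfE integral_restrict_expR// ?invr_ge0 ?ltW//.
rewrite AI integral_expR_itv// -EFinM; congr (_%:E).
have : expR (- la * d1) - expR (- la * d2) != 0.
  by move: Z0; rewrite pmulr_rgt0 ?invr_gt0// => /lt0r_neq0.
by move=> dn0; field; rewrite dn0 lt0r_neq0.
Qed.

Lemma stExp_setT (d1 d2 : R) : d1 < d2 -> stExp la d1 d2 setT = 1%E.
Proof.
move=> d12; rewrite (stExpE d12 d12)// ?setTI// divff//.
have := normalizer_gt0 d12; rewrite pmulr_rgt0 ?invr_gt0//.
exact: lt0r_neq0.
Qed.

Lemma sExp_setT (c : R) : sExp la c setT = 1%E.
Proof.
have Z0 : 0 < la^-1 * expR (- la * c) by rewrite mulr_gt0 ?invr_gt0 ?expR_gt0.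
rewrite /sExp sExp_pdfE integral_restrict_expR// ?invr_ge0 ?ltW// setTI.
by rewrite integral_expR_itvy -EFinM mulVf// lt0r_neq0.
Qed.

End exponential_mass.

(** If a < b, then [- b, a] has mass 1 under the second law, while the first law
gives positive mass to ]a, b]. *)
Lemma stExp_swap_inj {R : realType} (la a b : R) : 0 < la -> 0 < a -> 0 < b ->
  same_law (stExp la (- a) b) (stExp la (- b) a) -> a = b.
Proof.
move=> la_gt0.
wlog : a b / a < b => [H a0 b0 L|ab a0 b0 L].
  have [ab|ba|//] := ltgtP a b; first exact: H.
  by apply/esym/H => // A mA; apply/esym; exact: L.
have := L `[- b, a]%classic (measurable_itv _).
rewrite (stExpE la_gt0 (a := - a) (b := a))//; [|lra|lra|]; last first.
  by apply/seteqP; split => x/=; rewrite !in_itv/= => ?; lra.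
rewrite (stExpE la_gt0 (a := - b) (b := a))//; [|lra|lra|];
  last by rewrite setIid.
have e (x y : R) : x < y -> expR (- la * x) - expR (- la * y) != 0.
  move=> xy; have := normalizer_gt0 la_gt0 xy; rewrite pmulr_rgt0 ?invr_gt0//.
  exact: lt0r_neq0.
rewrite divff ?e//; last by lra.
move=> [] /(canRL (divfK (e _ _ _)))-/(_ ltac:(lra)).
rewrite mul1r => /addrI/oppr_inj/expR_inj/mulfI; apply.
by rewrite oppr_eq0 gt_eqF.
Qed.

(** * Exponential laws give independence *)

(** The product density is invariant up to the exchange of c1 and c2: the
exponentials depend only on x + y, the supports are exchanged by F3, and both
products of normalizing constants are la ^- 2 * (exp (la * (c1 + c2)) - 1). *)
Lemma exp_tensor_F3 {R : realType} (la c1 c2 : R) (p : R * R) :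
  tensor (stExp_pdf la (- c1) c2) (sExp_pdf la (- c2)) (F3 p) =
  tensor (stExp_pdf la (- c2) c1) (sExp_pdf la (- c1)) p.
Proof.
rewrite /tensor !stExp_pdfE !sExp_pdfE !patchE.
have mE (i : interval R) x : (x \in [set` i]) = (x \in i).
  by apply/idP/idP; rewrite inE.
rewrite !mE.
have ifM (b b' : bool) (x y : R) :
    (if b then x else 0) * (if b' then y else 0) = if b && b' then x * y else 0.
  by case: b; case: b'; rewrite ?mul0r ?mulr0.
rewrite !{}ifM.
rewrite F3_strip; case: ifP => // _.
rewrite mulrACA [RHS]mulrACA -!expRD -!mulrDr F3_sum; congr (_ * _).
rewrite -!invfM; congr (_ ^-1).
rewrite ![_ * (la^-1 * _)]mulrACA; congr (_ * _).
by rewrite !mulrBl -!expRD; congr (expR _ - expR _); ring.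
Qed.

Lemma pushforward_pairX d (T : measurableType d) (R : realType)
    (P : probability T R) (U V : T -> R) (f h : R -> R) (A B : set R) :
  measurable_fun setT f -> measurable_fun setT h ->
  (forall x, 0 <= f x) -> (forall x, 0 <= h x) ->
  (forall S : set (R * R), measurable S ->
    P ((fun w => (U w, V w)) @^-1` S) =
    (\int[leb \x leb]_(p in S) (tensor f h p)%:E)%E) ->
  measurable A -> measurable B ->
  P (U @^-1` A `&` V @^-1` B) =
  (\int[leb]_(x in A) (f x)%:E * \int[leb]_(y in B) (h y)%:E)%E.
Proof.
move=> mf mh f0 h0 UV mA mB.
rewrite -[LHS]/(P ((fun w => (U w, V w)) @^-1` (A `*` B))) UV.
  exact: integral_tensorX.
exact: measurableX.
Qed.

Lemma exp_independent d (T : measurableType d) (R : realType)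
    (P : probability T R) (X Y : {RV P >-> R}) (la c1 c2 : R) :
  0 < c1 -> 0 < c2 -> 0 < la -> independent_rv P X Y ->
  same_law (distribution P X) (stExp la (- c1) c2) ->
  same_law (distribution P Y) (sExp la (- c2)) ->
  let U w := (F3 (X w, Y w)).1 in
  let V w := (F3 (X w, Y w)).2 in
  [/\ independent_rv P U V,
      same_law (pushforward P U) (stExp la (- c2) c1)
    & same_law (pushforward P V) (sExp la (- c1))].
Proof.
move=> c1_gt0 c2_gt0 la_gt0 iXY lX lY U V.
have c12 : - c1 < c2 by lra.
have c21 : - c2 < c1 by lra.
have dX : has_density (distribution P X) (stExp_pdf la (- c1) c2).
  by split => //; [exact: measurable_stExp_pdf|exact: stExp_pdf_ge0].
have dY : has_density (distribution P Y) (sExp_pdf la (- c2)).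
  by split => //; [exact: measurable_sExp_pdf|exact: sExp_pdf_ge0].
have UVE (A B : set R) : measurable A -> measurable B ->
    P (U @^-1` A `&` V @^-1` B) = (stExp la (- c2) c1 A * sExp la (- c1) B)%E.
  apply: pushforward_pairX.
  - exact: measurable_stExp_pdf.
  - exact: measurable_sExp_pdf.
  - exact: stExp_pdf_ge0.
  - exact: sExp_pdf_ge0.
  move=> S mS; rewrite F3_pairE (joint_density_F3 iXY dX dY mS).
  by apply: eq_integral => p _; rewrite exp_tensor_F3.
have lU : same_law (pushforward P U) (stExp la (- c2) c1).
  move=> A mA; have := UVE A setT mA measurableT.
  by rewrite preimage_setT setIT sExp_setT// mule1.
have lV : same_law (pushforward P V) (sExp la (- c1)).
  move=> B mB; have := UVE setT B measurableT mB.
  by rewrite preimage_setT setTI stExp_setT// mul1e.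
split => // A B mA mB; rewrite UVE//.
by rewrite -[P (U @^-1` A)]/(pushforward P U A) lU// -lV.
Qed.

(** * Independence gives exponential laws *)

(** Two points are negligible, and the factor k is 1 since both sides have total
mass 1. *)
Lemma proportional_density_law {R : realType} (mu : set R -> \bar R)
    (f q : R -> R) (k a b : R) :
  has_density mu f -> mu setT = 1%E ->
  measurable_fun setT q -> (forall x, 0 <= q x) ->
  (\int[leb]_x (q x)%:E = 1)%E -> 0 <= k ->
  (forall x, x != a -> x != b -> f x = k * q x) ->
  same_law mu (fun A => \int[leb]_(x in A) (q x)%:E)%E.
Proof.
move=> [mf f0 lf] mu1 mq q0 q1 k0 fq.
have muE A : measurable A -> mu A = (k%:E * \int[leb]_(x in A) (q x)%:E)%E.
  move=> mA; rewrite lf// -ge0_integralZl//; last 2 first.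
  - by apply/measurable_EFinP; exact: measurable_funTS.
  - by move=> x _; rewrite lee_fin.
  apply: ge0_ae_eq_integral => //.
  - by apply/measurable_EFinP; exact: measurable_funTS.
  - apply/measurable_EFinP; apply: measurable_funM => //.
    exact: measurable_funTS.
  - by move=> x _; rewrite lee_fin.
  - by move=> x _; rewrite -EFinM lee_fin mulr_ge0.
  exists [set a; b]; split.
  - exact: measurableU.
  - have ab0 : (leb [set a] + leb [set b] = 0 :> \bar R)%E.
      by rewrite !lebesgue_measure_set1 adde0.
    apply/eqP; rewrite -measure_le0 -[leRHS]ab0.
    by apply: measureU2; exact: measurable_set1.
  - move=> x /= /not_implyP[_ fqx]; apply: contrapT => /not_orP[xa xb].
    by apply: fqx; rewrite fq//; exact/eqP.
have k1 : k = 1.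
  by have := muE setT measurableT; rewrite mu1 q1 mule1 => -[].
by move=> A mA; rewrite muE// k1 mul1e.
Qed.

(** Otherwise h >= h 0 on the interval [0, 2 / h 0], which would then have mass
at least 2. *)
Lemma exp_density_rate_gt0 {R : realType} (h : R -> R) (la : R) :
  measurable_fun setT h -> (forall x, 0 <= h x) ->
  (\int[leb]_x (h x)%:E = 1)%E -> 0 < h 0 ->
  (forall y, 0 <= y -> h y = h 0 * expR (- la * y)) -> 0 < la.
Proof.
move=> mh h_ge0 h1 h00 hE; rewrite ltNge; apply/negP => la0.
have N0 : 0 < 2 / h 0 by rewrite divr_gt0.
suff : (2%:E <= 1 :> \bar R)%E by rewrite lee_fin; lra.
rewrite -[leRHS]h1.
apply: (@le_trans _ _ (\int[leb]_(x in `[0%R, (2 / h 0)%R]) (h x)%:E)%E).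
  apply: (@le_trans _ _ (\int[leb]_(x in `[0%R, (2 / h 0)%R]) (h 0)%:E)%E).
    rewrite integral_cst//= lebesgue_measure_itv/= lte_fin N0 -EFinB -EFinM.
    by rewrite subr0 mulrCA divff ?mulr1// lt0r_neq0.
  apply: ge0_le_integral => //.
  - by move=> x _; rewrite lee_fin.
  - by apply/measurable_EFinP; exact: measurable_funTS.
  - move=> x /=; rewrite in_itv/= => /andP[x0 _].
    rewrite lee_fin (hE x)//; apply: ler_peMr; first exact: ltW.
    rewrite -expR0 ler_expR.
    by rewrite mulr_ge0// oppr_ge0.
apply: ge0_subset_integral => //.
- exact/measurable_EFinP.
- by move=> x _; rewrite lee_fin.
Qed.

(** F3 maps the interior of the support of (U, V) into the interior of the
support of (X, Y), and is continuous across the line u + v = 0. *)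
Lemma continuous_tensor_F3 {R : realType} (c1 c2 : R) (f h : R -> R) (u v : R) :
  (forall x, x \in `]- c1, c2[ -> {for x, continuous f}) ->
  (forall y, y \in `]- c2, +oo[ -> {for y, continuous h}) ->
  u \in `]- c2, c1[ -> v \in `]- c1, +oo[ ->
  {for (u, v), continuous (fun p => tensor f h (F3 p))}.
Proof.
rewrite !in_itv/= andbT => cf ch /andP[u1 u2] v1.
have [x1 x2 y1] : [/\ - c1 < (F3 (u, v)).1, (F3 (u, v)).1 < c2
    & - c2 < (F3 (u, v)).2].
  have [uv|/ltW uv] := leP (u + v) 0.
    by rewrite F3_below//=; split; lra.
  by rewrite F3_above//=; split; lra.
have cF := @continuous_F3 R (u, v).
have cfst : continuous (@fst R R) by move=> p; exact: cvg_fst.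
have csnd : continuous (@snd R R) by move=> p; exact: cvg_snd.
apply: cvgM.
- apply: (@cvg_comp _ _ _ (fun p => (F3 p).1) f); last first.
    by apply: cf; rewrite in_itv/= x1.
  exact: (cvg_comp F3 fst cF (cfst _)).
- apply: (@cvg_comp _ _ _ (fun p => (F3 p).2) h); last first.
    by apply: ch; rewrite in_itv/= andbT.
  exact: (cvg_comp F3 snd cF (csnd _)).
Qed.

Lemma independent_F3_exponential d (T : measurableType d) (R : realType)
    (P : probability T R) (X Y : {RV P >-> R}) (c1 c2 : R) (fX fY : R -> R) :
  0 < c1 -> 0 < c2 -> independent_rv P X Y ->
  has_density (distribution P X) fX ->
  has_density (distribution P Y) fY ->
  (forall x, x \in `[- c1, c2] -> 0 < fX x) ->
  (forall x, x \notin `[- c1, c2] -> fX x = 0) ->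
  (forall y, y \in `[- c2, +oo[ -> 0 < fY y) ->
  (forall y, y \notin `[- c2, +oo[ -> fY y = 0) ->
  (forall x, x \in `]- c1, c2[ -> derivable fX x 1) ->
  (forall y, y \in `]- c2, +oo[ -> derivable fY y 1) ->
  independent_rv P (fun w => (F3 (X w, Y w)).1) (fun w => (F3 (X w, Y w)).2) ->
  exists2 la : R, 0 < la &
    same_law (distribution P X) (stExp la (- c1) c2) /\
    same_law (distribution P Y) (sExp la (- c2)).
Proof.
move=> c1_gt0 c2_gt0 iXY dX dY fX0 fXn fY0 fYn fXd fYd iUV.
have [mf f0 lX] := dX; have [mh h0 lY] := dY.
have X1 : distribution P X setT = 1%E := probability_setT (distribution P X).
have Y1 : distribution P Y setT = 1%E := probability_setT (distribution P Y).
have cont (f : R -> R) x : derivable f x 1 -> {for x, continuous f}.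
  by move=> /derivable1_diffP/differentiable_continuous.
have oc x : x \in `]- c1, c2[ -> x \in `[- c1, c2].
  exact: subset_itv_oo_cc.
have ocy y : y \in `]- c2, +oo[ -> y \in `[- c2, +oo[.
  by rewrite !in_itv/= !andbT; exact: ltW.
have mFXY : measurable_fun setT (fun w => F3 (X w, Y w)).
  by apply: measurableT_comp measurable_F3 _; exact: measurable_fun_pair.
have cg u v : u \in `]- c2, c1[ -> v \in `]- c1, +oo[ ->
    {for (u, v), continuous (fun p => tensor fX fY (F3 p))}.
  apply: continuous_tensor_F3 => x xi; first exact/cont/fXd.
  exact/cont/fYd.
have [la [fXE fYE]] : exists la : R,
    (forall x, x \in `]- c1, c2[ -> fX x = fX 0 * expR (- la * x)) /\
    (forall y, y \in `]- c2, +oo[ -> fY y = fY 0 * expR (- la * y)).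
  apply: (@rank1_exponential R c1 c2 fX fY fX^`()%classic fY^`()%classic) => //.
  - by move=> x /oc; exact: fX0.
  - by move=> y /ocy; exact: fY0.
  - by move=> x /fXd ?; rewrite derive1E; exact: DeriveDef.
  - by move=> y /fYd ?; rewrite derive1E; exact: DeriveDef.
  move=> u v u' v' ui vi u'i v'i.
  apply: (independent_density_rank1 _ _ _ _ _ iUV
    (g := fun p => tensor fX fY (F3 p))); try exact: cg.
  - exact: measurableT_comp (measurable_tensor mf mh) measurable_F3.
  - by move=> q; exact: tensor_ge0.
  - by move=> S mS; rewrite F3_pairE (joint_density_F3 iXY dX dY mS).
  - exact: measurableT_comp measurable_fst mFXY.
  - exact: measurableT_comp measurable_snd mFXY.
have fX00 : 0 < fX 0 by apply: fX0; rewrite in_itv/=; lra.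
have fY00 : 0 < fY 0 by apply: fY0; rewrite in_itv/=; lra.
have la_gt0 : 0 < la.
  apply: (exp_density_rate_gt0 mh h0 _ fY00).
  - by rewrite -lY.
  - by move=> y y0; apply: fYE; rewrite in_itv/= andbT; lra.
exists la => //; split.
- have c12 : - c1 < c2 by lra.
  have Z0 := normalizer_gt0 la_gt0 c12.
  apply: (proportional_density_law dX X1 _ _ _ _ (a := - c1) (b := c2)
    (k := fX 0 * (la^-1 * (expR (- la * - c1) - expR (- la * c2))))).
  + exact: measurable_stExp_pdf.
  + exact: stExp_pdf_ge0.
  + exact: stExp_setT.
  + by rewrite ltW// mulr_gt0.
  move=> x xa xb; rewrite stExp_pdfE patchE.
  case: ifPn => [|xn]; last first.
    by rewrite mulr0 fXn//; apply: contra xn; rewrite inE.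
  rewrite inE/= in_itv/= => /andP[ax xb'].
  rewrite fXE; last by rewrite in_itv/= !lt_neqAle ax xb' xb eq_sym xa.
  by rewrite -mulrA mulVKf// lt0r_neq0.
- have Z0 : 0 < la^-1 * expR (- la * - c2).
    by rewrite mulr_gt0 ?invr_gt0 ?expR_gt0.
  apply: (proportional_density_law dY Y1 _ _ _ _ (a := - c2) (b := - c2)
    (k := fY 0 * (la^-1 * expR (- la * - c2)))).
  + exact: measurable_sExp_pdf.
  + exact: sExp_pdf_ge0.
  + exact: sExp_setT.
  + by rewrite ltW// mulr_gt0.
  move=> y ya _; rewrite sExp_pdfE patchE.
  case: ifPn => [|yn]; last first.
    by rewrite mulr0 fYn//; apply: contra yn; rewrite inE.
  rewrite inE/= in_itv/= andbT => ay.
  rewrite fYE; last by rewrite in_itv/= andbT lt_neqAle ay eq_sym ya.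
  by rewrite -mulrA mulVKf// lt0r_neq0.
Qed.

(** * The characterization *)

Lemma same_joint_law_marginals d (T : measurableType d) (R : realType)
    (P : probability T R) (X Y U V : T -> R) :
  same_law (pushforward P (fun w => (U w, V w)))
           (pushforward P (fun w => (X w, Y w))) ->
  same_law (pushforward P U) (pushforward P X) /\
  same_law (pushforward P V) (pushforward P Y).
Proof.
move=> UVXY; split => A mA; rewrite /pushforward.
- have pre (W Z : T -> R) : W @^-1` A =
      (fun w => (W w, Z w)) @^-1` (A `*` setT).
    by apply/seteqP; split => w //= [].
  rewrite (pre U V) (pre X Y).
  exact: (UVXY _ (measurableX mA measurableT)).
- have pre (W Z : T -> R) : Z @^-1` A =
      (fun w => (W w, Z w)) @^-1` (setT `*` A).
    by apply/seteqP; split => w //= [].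
  rewrite (pre U V) (pre X Y).
  exact: (UVXY _ (measurableX measurableT mA)).
Qed.

Lemma independent_same_joint_law d (T : measurableType d) (R : realType)
    (P : probability T R) (X Y U V : T -> R) :
  same_law (pushforward P (fun w => (U w, V w)))
           (pushforward P (fun w => (X w, Y w))) ->
  independent_rv P X Y -> independent_rv P U V.
Proof.
move=> UVXY iXY A B mA mB; have [UX VY] := same_joint_law_marginals UVXY.
have -> : P (U @^-1` A) = P (X @^-1` A) := UX A mA.
have -> : P (V @^-1` B) = P (Y @^-1` B) := VY B mB.
rewrite -iXY//; exact: (UVXY _ (measurableX mA mB)).
Qed.

Theorem theorem1p3 (R : realType) (c1 c2 : R) (c1_gt0 : 0 < c1)
    (c2_gt0 : 0 < c2) :
  [/\ involutive (@F3 R),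
      set_bij (`[- c1, c2] `*` `[- c2, +oo[) (`[- c2, c1] `*` `[- c1, +oo[)
        (@F3 R),
      forall (d : measure_display) (T : measurableType d)
        (P : probability T R) (X Y : {RV P >-> R}) (fX fY : R -> R),
        independent_rv P X Y ->
        has_density (distribution P X) fX ->
        has_density (distribution P Y) fY ->
        (forall x, x \in `[- c1, c2] -> 0 < fX x) ->
        (forall x, x \notin `[- c1, c2] -> fX x = 0) ->
        (forall y, y \in `[- c2, +oo[ -> 0 < fY y) ->
        (forall y, y \notin `[- c2, +oo[ -> fY y = 0) ->
        twice_differentiable_on `]- c1, c2[ fX ->
        twice_differentiable_on `]- c2, +oo[ fY ->
        let XY := fun w : T => (X w, Y w) in
        let UV := fun w : T => F3 (XY w) in
        let U := fun w : T => (UV w).1 in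
        let V := fun w : T => (UV w).2 in
        [/\ independent_rv P U V <->
              exists2 lambda : R, 0 < lambda &
                same_law (distribution P X) (stExp lambda (- c1) c2) /\
                same_law (distribution P Y) (sExp lambda (- c2)),
            forall lambda : R, 0 < lambda ->
              same_law (distribution P X) (stExp lambda (- c1) c2) ->
              same_law (distribution P Y) (sExp lambda (- c2)) ->
              [/\ same_law (pushforward P U) (stExp lambda (- c2) c1),
                  same_law (pushforward P V) (sExp lambda (- c1))
                & same_law (pushforward P UV) (pushforward P XY) ->
                  exists2 c : R, 0 < c &
                    same_law (distribution P X) (stExp lambda (- c) c) /\
                    same_law (distribution P Y) (sExp lambda (- c))]
          & same_law (pushforward P UV) (pushforward P XY) ->
              exists lambda c : R,
                [/\ 0 < lambda, 0 < c,
                    same_law (distribution P X) (stExp lambda (- c) c)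
                  & same_law (distribution P Y) (sExp lambda (- c))]]
    & forall c : R, 0 < c ->
        set_fun (`[- c, c] `*` `[- c, +oo[) (`[- c, c] `*` `[- c, +oo[)
          (@F3 R) /\
        (forall p : R * R, (`[- c, c] `*` `[- c, +oo[) p -> F3 (F3 p) = p)].
Proof.
split.
- exact: F3_involutive.
- exact: F3_strip_bij.
- move=> d T P X Y fX fY iXY dX dY fX0 fXn fY0 fYn fXd fYd XY UV U V.
  have exp_of_indep : independent_rv P U V -> exists2 lambda : R, 0 < lambda &
      same_law (distribution P X) (stExp lambda (- c1) c2) /\
      same_law (distribution P Y) (sExp lambda (- c2)).
    apply: (independent_F3_exponential c1_gt0 c2_gt0 iXY dX dY) => //.
    + by move=> x xi; have [] := fXd x xi.
    + by move=> y yi; have [] := fYd y yi.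
  have UVE : UV = fun w => (U w, V w) by rewrite -F3_pairE.
  have c1_eq_c2 (la : R) : 0 < la ->
      same_law (distribution P X) (stExp la (- c1) c2) ->
      same_law (pushforward P U) (stExp la (- c2) c1) ->
      same_law (pushforward P UV) (pushforward P XY) -> c1 = c2.
    rewrite UVE => la0 lX lU /same_joint_law_marginals[UX _].
    apply: (stExp_swap_inj la0) => // A mA.
    by rewrite -lX// -lU//; apply/esym; exact: UX.
  split.
  + split; first exact: exp_of_indep.
    move=> [la la0 [lX lY]].
    by have [] := exp_independent c1_gt0 c2_gt0 la0 iXY lX lY.
  + move=> la la0 lX lY.
    have [_ lU lV] := exp_independent c1_gt0 c2_gt0 la0 iXY lX lY.
    split => // UVXY.
    have c12 := c1_eq_c2 la la0 lX lU UVXY.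
    by exists c1 => //; split; [rewrite {2}c12|rewrite c12].
  + move=> UVXY.
    have iUV : independent_rv P U V.
      by apply: independent_same_joint_law iXY; rewrite -UVE.
    have [la la0 [lX lY]] := exp_of_indep iUV.
    have [_ lU _] := exp_independent c1_gt0 c2_gt0 la0 iXY lX lY.
    have c12 := c1_eq_c2 la la0 lX lU UVXY.
    by exists la, c1; split => //; [rewrite {2}c12|rewrite c12].
- move=> c c0; split; last by move=> p _; exact: F3_involutive.
  by have [] := @F3_strip_bij R c c.
Qed.
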